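(* Let $G_i$ be a generator over $\Sigma_i$ for $i=1,2,k$, let $L=L(G_1\|G_2\|G_k)$, and let $K\subseteq L$ be a prefix-closed language that is conditionally decomposable with respect to $\Sigma_1,\Sigma_2,\Sigma_k$. Define $$\mathrm{supC}_k=\mathrm{supC}(P_k(K),L(G_k),\Sigma_{k,u}),\qquad \mathrm{supC}_{i+k}=\mathrm{supC}(P_{i+k}(K),L(G_i)\|\overline{\mathrm{supC}_k},\Sigma_{i+k,u}),\quad i=1,2.$$ Assume that, for $i=1,2$, the projection $P_k^{i+k}$ is a $(P_i^{i+k})^{-1}(L(G_i))$-observer and is LCC for the language $(P_i^{i+k})^{-1}(L(G_i))$. Then $$\mathrm{supC}_{1+k}\,\|\,\mathrm{supC}_{2+k}=\mathrm{supcC}(K,L,(\Sigma_{1,u},\Sigma_{2,u},\Sigma_{k,u})),$$ the supremal conditionally controllable sublanguage of $K$.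
   Context: A generator $G=(Q,\Sigma,f,q_0,Q_m)$ is a deterministic finite automaton with partial transition function; $L(G)$ is the set of words $s$ with $f(q_0,s)$ defined. Languages given as data are regular. $\overline{M}$ is the prefix closure of $M$. Let $\Sigma=\Sigma_1\cup\Sigma_2$, with $\Sigma_u\subseteq\Sigma$ the uncontrollable events, $\Sigma_{j,u}=\Sigma_j\cap\Sigma_u$ for $j=1,2,k$, and $\Sigma_{i+k,u}=(\Sigma_i\cup\Sigma_k)\cap\Sigma_u$. Projections erase events outside the target event set: $P_k:\Sigma^*\to\Sigma_k^*$, $P_{i+k}:\Sigma^*\to(\Sigma_i\cup\Sigma_k)^*$, $P_k^{i+k}:(\Sigma_i\cup\Sigma_k)^*\to\Sigma_k^*$, $P_i^{i+k}:(\Sigma_i\cup\Sigma_k)^*\to\Sigma_i^*$. The synchronous product of languages $L_i$ over $A_i$ is the set of words over $\bigcup_iA_i$ whose projection to $A_i^*$ is in $L_i$ for every $i$; $L(G\|G')=L(G)\|L(G')$. $M\subseteq\Sigma^*$ is conditionally decomposable with respect to $\Sigma_1,\Sigma_2,\Sigma_k$, where $\Sigma_1\cap\Sigma_2\subseteq\Sigma_k\subseteq\Sigma_1\cup\Sigma_2$, if $M=P_{1+k}(M)\|P_{2+k}(M)$. $M$ is controllable with respect to a prefix-closed language $N$ and event set $U$ if $\overline{M}U\cap N\subseteq\overline{M}$. $\mathrm{supC}(M,N,U)$ is the union of all languages $M'\subseteq M\cap N$ controllable with respect to $N$ and $U$. A language $M\subseteq L(G_1\|G_2\|G_k)$ is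 conditionally controllable for $G_1,G_2,G_k$ and $\Sigma_{1,u},\Sigma_{2,u},\Sigma_{k,u}$ if $P_k(M)$ is controllable with respect to $L(G_k)$ and $\Sigma_{k,u}$, and for $i=1,2$, $P_{i+k}(M)$ is controllable with respect to $L(G_i)\|\overline{P_k(M)}$ and $\Sigma_{i+k,u}$. $\mathrm{supcC}(K,L,(\Sigma_{1,u},\Sigma_{2,u},\Sigma_{k,u}))$ is the largest conditionally controllable sublanguage of $K$, equal to the union of all conditionally controllable sublanguages of $K$. Let $A_0\subseteq A$ be event sets and $P:A^*\to A_0^*$ the projection. $P$ is an $M$-observer for $M\subseteq A^*$ if for all $t\in P(M)$ and $s\in\overline{M}$ such that $P(s)$ is a prefix of $t$, there is $u\in A^*$ with $su\in M$ and $P(su)=t$. $P$ is locally control consistent (LCC) for a prefix-closed $M\subseteq A^*$ if for every $s\in M$ and every $\sigma\in A_0\cap\Sigma_u$ with $P(s)\sigma\in P(M)$, either there is no $u\in(A\setminus A_0)^*$ with $su\sigma\in M$, or there is $u\in((A\cap\Sigma_u)\setminus A_0)^*$ with $su\sigma\in M$. *)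

(* Defs.v *)
From mathcomp Require Import all_boot.
From mathcomp Require Import boolp classical_sets.

Set Implicit Arguments.
Unset Strict Implicit.
Unset Printing Implicit Defensive.

Local Open Scope classical_set_scope.

(* Event sets are finite sets over one ambient finite type [E], so that words
   over different event sets share the type [seq E]; [words A] is A^*. *)
Definition words (E : finType) (A : {set E}) : set (seq E) :=
  [set w | all [in A] w].

(* The projection onto A^*.  Its domain plays no role in its value, so P_k and
   P_k^{i+k} are both [proj Sk]. *)
Definition proj (E : finType) (A : {set E}) (w : seq E) : seq E :=
  [seq e <- w | e \in A].

(* The inverse image of [N] under the projection A^* -> A0^*. *)
Definition invproj (E : finType) (A A0 : {set E}) (N : set (seq E)) :
    set (seq E) :=
  words A `&` proj A0 @^-1` N.

Definition pclosure (E : finType) (M : set (seq E)) : set (seq E) :=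
  [set s | exists u, M (s ++ u)].

Definition prefix_closed (E : finType) (M : set (seq E)) : Prop :=
  pclosure M = M.

Definition sync (E : finType) (A1 : {set E}) (M1 : set (seq E))
    (A2 : {set E}) (M2 : set (seq E)) : set (seq E) :=
  [set w | [/\ words (A1 :|: A2) w, M1 (proj A1 w) & M2 (proj A2 w)]].

Record generator (E : finType) (A : {set E}) := Generator {
  state : finType;
  trans : state -> E -> option state;
  init : state;
  marked : {set state};
  trans_alph : forall q e, e \notin A -> trans q e = None
}.

Fixpoint run (E : finType) (A : {set E}) (G : generator A) (q : state G)
    (w : seq E) : option (state G) :=
  if w is e :: w' then
    if trans q e is Some q' then run q' w' else None
  else Some q.

Definition lang (E : finType) (A : {set E}) (G : generator A) :
    set (seq E) :=
  [set w | run (init G) w != None].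

Definition mlang (E : finType) (A : {set E}) (G : generator A) :
    set (seq E) :=
  [set w | exists2 q, run (init G) w = Some q & q \in marked G].

Definition regular (E : finType) (A : {set E}) (M : set (seq E)) : Prop :=
  exists G : generator A, M = mlang G.

(* Synchronous product of generators: each component moves on its own events
   and stays put on the others. *)
Definition local_step (E : finType) (A : {set E}) (G : generator A)
    (q : state G) (e : E) : option (state G) :=
  if e \in A then trans q e else Some q.

Definition gsync_trans (E : finType) (A1 A2 : {set E}) (G1 : generator A1)
    (G2 : generator A2) (q : state G1 * state G2) (e : E) :
    option (state G1 * state G2)%type :=
  if e \in A1 :|: A2 then
    match local_step q.1 e, local_step q.2 e with
    | Some q1, Some q2 => Some (q1, q2)
    | _, _ => None
    end
  else None.

Lemma gsync_trans_alph (E : finType) (A1 A2 : {set E}) (G1 : generator A1)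
    (G2 : generator A2) (q : state G1 * state G2) (e : E) :
  e \notin A1 :|: A2 -> gsync_trans q e = None.
Proof. by rewrite /gsync_trans => /negPf ->. Qed.

Definition gsync (E : finType) (A1 A2 : {set E}) (G1 : generator A1)
    (G2 : generator A2) : generator (A1 :|: A2) :=
  @Generator E (A1 :|: A2) (state G1 * state G2)%type
    (@gsync_trans E A1 A2 G1 G2) (init G1, init G2)
    (finset.setX (marked G1) (marked G2)) (@gsync_trans_alph E A1 A2 G1 G2).

Definition cond_decomposable (E : finType) (S1 S2 Sk : {set E})
    (M : set (seq E)) : Prop :=
  M = sync (S1 :|: Sk) (proj (S1 :|: Sk) @` M)
           (S2 :|: Sk) (proj (S2 :|: Sk) @` M).

Definition controllable (E : finType) (M N : set (seq E)) (U : {set E}) :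
    Prop :=
  forall s e, pclosure M s -> e \in U -> N (rcons s e) ->
    pclosure M (rcons s e).

Definition supC (E : finType) (M N : set (seq E)) (U : {set E}) :
    set (seq E) :=
  \bigcup_(M' in [set M' | M' `<=` M `&` N /\ controllable M' N U]) M'.

Definition cond_controllable (E : finType) (S1 S2 Sk Su : {set E})
    (G1 : generator S1) (G2 : generator S2) (Gk : generator Sk)
    (M : set (seq E)) : Prop :=
  [/\ M `<=` lang (gsync (gsync G1 G2) Gk),
      controllable (proj Sk @` M) (lang Gk) (Sk :&: Su),
      controllable (proj (S1 :|: Sk) @` M)
        (sync S1 (lang G1) Sk (pclosure (proj Sk @` M)))
        ((S1 :|: Sk) :&: Su)
    & controllable (proj (S2 :|: Sk) @` M)
        (sync S2 (lang G2) Sk (pclosure (proj Sk @` M)))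
        ((S2 :|: Sk) :&: Su)].

(* [supcC_greatest] below shows that this union is itself conditionally
   controllable, i.e. that it is the largest such sublanguage of [K]. *)
Definition supcC (E : finType) (S1 S2 Sk Su : {set E})
    (G1 : generator S1) (G2 : generator S2) (Gk : generator Sk)
    (K : set (seq E)) : set (seq E) :=
  \bigcup_(M in [set M | M `<=` K /\ cond_controllable Su G1 G2 Gk M]) M.

(* The projection A^* -> A0^* is an [M]-observer. *)
Definition observer (E : finType) (A A0 : {set E}) (M : set (seq E)) : Prop :=
  forall t s, (proj A0 @` M) t -> pclosure M s -> prefix (proj A0 s) t ->
    exists u, [/\ words A u, M (s ++ u) & proj A0 (s ++ u) = t].

(* The projection A^* -> A0^* is locally control consistent for [M]. *)
Definition lcc (E : finType) (A A0 Su : {set E}) (M : set (seq E)) : Prop :=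
  forall s e, M s -> e \in A0 :&: Su ->
    (proj A0 @` M) (rcons (proj A0 s) e) ->
    (~ exists u, words (A :\: A0) u /\ M (s ++ rcons u e)) \/
    (exists u, words ((A :&: Su) :\: A0) u /\ M (s ++ rcons u e)).

Lemma run_cat (E : finType) (A : {set E}) (G : generator A) (q : state G)
    (s u : seq E) :
  run q (s ++ u) = obind (fun q' => run q' u) (run q s).
Proof. by elim: s q => //= e s IH q; case: (trans q e). Qed.

Lemma lang_prefix_closed (E : finType) (A : {set E}) (G : generator A) :
  prefix_closed (lang G).
Proof.
apply/seteqP; split=> s; last by exists [::]; rewrite cats0.
by case=> u; rewrite /lang /= run_cat; case: (run _ s).
Qed.

Lemma lang_gsync (E : finType) (A1 A2 : {set E}) (G1 : generator A1)
    (G2 : generator A2) :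
  lang (gsync G1 G2) = sync A1 (lang G1) A2 (lang G2).
Proof.
have aux w (q1 : state G1) (q2 : state G2) :
    (@run _ _ (gsync G1 G2) (q1, q2) w != None) =
    [&& all [in A1 :|: A2] w, run q1 (proj A1 w) != None
      & run q2 (proj A2 w) != None].
  elim: w q1 q2 => //= e w IH q1 q2.
  rewrite /gsync_trans /local_step /proj /=.
  case: ifP => //; rewrite finset.in_setU.
  case: (e \in A1); case: (e \in A2) => //= _.
  - case: (trans q1 e) => [r1|] /=; last by rewrite andbF.
    case: (trans q2 e) => [r2|] /=; last by rewrite !andbF.
    exact: IH.
  - by case: (trans q1 e) => [r1|] /=; [exact: IH|rewrite andbF].
  - by case: (trans q2 e) => [r2|] /=; [exact: IH|rewrite !andbF].
apply/seteqP; split=> w; rewrite /lang /sync /words /= aux.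
  by case/and3P.
by case=> -> -> ->.
Qed.

Lemma proj_cat (E : finType) (A : {set E}) (s u : seq E) :
  proj A (s ++ u) = proj A s ++ proj A u.
Proof. exact: filter_cat. Qed.

Lemma proj_rcons (E : finType) (A : {set E}) (s : seq E) (e : E) :
  proj A (rcons s e) = if e \in A then rcons (proj A s) e else proj A s.
Proof. exact: filter_rcons. Qed.

Lemma proj_proj (E : finType) (A A0 : {set E}) (s : seq E) :
  A0 \subset A -> proj A0 (proj A s) = proj A0 s.
Proof.
move=> /fintype.subsetP sA; rewrite /proj -filter_predI.
by apply: eq_filter => e /=; case: (boolP (e \in A0)) => // /sA ->.
Qed.

Lemma supcC_greatest (E : finType) (S1 S2 Sk Su : {set E})
    (G1 : generator S1) (G2 : generator S2) (Gk : generator Sk)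
    (K : set (seq E)) :
  [/\ supcC Su G1 G2 Gk K `<=` K,
      cond_controllable Su G1 G2 Gk (supcC Su G1 G2 Gk K)
    & forall M, M `<=` K -> cond_controllable Su G1 G2 Gk M ->
        M `<=` supcC Su G1 G2 Gk K].
Proof.
set U := supcC _ _ _ _ _.
have UL : U `<=` lang (gsync (gsync G1 G2) Gk).
  by move=> w [M [_ [ML _ _ _]] Mw]; exact: ML.
have pU A s : pclosure (proj A @` U) s -> exists M,
    [/\ M `<=` K, cond_controllable Su G1 G2 Gk M & pclosure (proj A @` M) s].
  by case=> u [w [M [MK Mc] Mw] e]; exists M; split=> //; exists u, w.
have sub M A : M `<=` K -> cond_controllable Su G1 G2 Gk M ->
    pclosure (proj A @` M) `<=` pclosure (proj A @` U).
  by move=> MK Mc s [u [w Mw e]]; exists u, w => //; exists M.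
have PkL s : pclosure (proj Sk @` U) s -> lang Gk s.
  case=> u [w /UL]; rewrite lang_gsync => -[_ _ Lw] e.
  by rewrite -(lang_prefix_closed Gk); exists u; rewrite -e.
have key Si (Gi : generator Si) s e M :
    M `<=` K -> cond_controllable Su G1 G2 Gk M ->
    pclosure (proj (Si :|: Sk) @` M) s -> e \in (Si :|: Sk) :&: Su ->
    sync Si (lang Gi) Sk (pclosure (proj Sk @` U)) (rcons s e) ->
    sync Si (lang Gi) Sk (pclosure (proj Sk @` M)) (rcons s e).
  move=> MK [_ Mk _ _] [u [w Mw ew]] /finset.setIP[_ eSu] [ws Ls Us]; split=> //.
  have Ms : pclosure (proj Sk @` M) (proj Sk s).
    exists (proj Sk u), w => //.
    by rewrite -proj_cat -ew proj_proj ?finset.subsetUr.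
  move: Us; rewrite proj_rcons; case: ifP => // eSk Us.
  by apply: Mk => //; [rewrite inE eSk|exact: PkL].
split.
- by move=> w [M [MK _] Mw]; exact: MK.
- split=> //.
  + move=> s e /pU[M [MK Mc Ms]] eU Le; apply: (sub _ _ MK Mc).
    by case: Mc => _ Mk _ _; exact: Mk.
  + move=> s e /pU[M [MK Mc Ms]] eU Le; apply: (sub _ _ MK Mc).
    have := key _ _ _ _ _ MK Mc Ms eU Le.
    by case: Mc => _ _ M1 _; exact: M1.
  + move=> s e /pU[M [MK Mc Ms]] eU Le; apply: (sub _ _ MK Mc).
    have := key _ _ _ _ _ MK Mc Ms eU Le.
    by case: Mc => _ _ _ M2; exact: M2.
- by move=> M MK Mc w Mw; exists M.
Qed.

(* Main.v *)
Require Import Defs.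
From mathcomp Require Import all_boot.
From mathcomp Require Import boolp classical_sets.

Set Implicit Arguments.
Unset Strict Implicit.
Unset Printing Implicit Defensive.

Local Open Scope classical_set_scope.

(** Write C_k and C_i for supC_k and supC_{i+k}; they are prefix-closed because
    K is.  The crux is that P_k(C_1 || C_2) is controllable: if w in C_i and
    P_k(w)e is in C_k with e uncontrollable, the observer property yields some
    continuation of w realising e inside the inverse image of L(G_i), LCC makes
    the part before e uncontrollable, and controllability of C_i then keeps
    the whole continuation in C_i.  Words of C_1 and C_2 with a common
    projection to Sigma_k merge because the alphabets meet only in Sigma_k. *)

(** * Prefix closure and projections of languages *)

Section Languages.
Variable E : finType.
Implicit Types (A B C U : {set E}) (M N : set (seq E)) (s t u v w : seq E).

Lemma pclosure_pclosure M : pclosure (pclosure M) = pclosure M.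
Proof.
apply/seteqP; split=> s; last by move=> ?; exists [::]; rewrite cats0.
by case=> u [v Msuv]; exists (u ++ v); rewrite catA.
Qed.

Lemma subset_pclosure M : M `<=` pclosure M.
Proof. by move=> s Ms; exists [::]; rewrite cats0. Qed.

Lemma pclosure_subset M N : M `<=` N -> pclosure M `<=` pclosure N.
Proof. by move=> MN s [u /MN]; exists u. Qed.

Lemma prefix_closed_catl M s u : prefix_closed M -> M (s ++ u) -> M s.
Proof. by move=> {2}<- Msu; exists u. Qed.

Lemma prefix_closedW M : (forall s u, M (s ++ u) -> M s) -> prefix_closed M.
Proof.
by move=> catl; apply/seteqP; split=> [s [u /catl]|]; last exact: subset_pclosure.
Qed.

(** Cut [w] just before the letter that starts [u]. This is what carries prefix closure through
    projections. *)
Lemma proj_eq_cat A w s u : proj A w = s ++ u ->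
  exists w1 w2, [/\ w = w1 ++ w2, proj A w1 = s & proj A w2 = u].
Proof.
elim: w s => [|e w IH] s /=; first by case: s => //= <-; exists [::], [::].
case: ifP => [eA|eA /IH[w1 [w2 [-> p1 p2]]]]; last first.
  by exists (e :: w1), w2; rewrite /= eA.
case: s => [|e' s] /=; first by move=> <-; exists [::], (e :: w); rewrite /= eA.
case=> <- /IH[w1 [w2 [-> p1 p2]]].
by exists (e :: w1), w2; rewrite /= eA -/(proj A w1) p1.
Qed.

Lemma prefix_closed_proj A M : prefix_closed M -> prefix_closed (proj A @` M).
Proof.
move=> clM; apply: prefix_closedW => s u [w Mw /proj_eq_cat[w1 [w2 [ew <- _]]]].
by exists w1 => //; apply: (@prefix_closed_catl _ _ w2) => //; rewrite -ew.
Qed.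

Lemma words_proj A w : words A (proj A w).
Proof. exact: filter_all. Qed.

Lemma words_catl A s u : words A (s ++ u) -> words A s.
Proof. by rewrite /words /= all_cat => /andP[]. Qed.

Lemma proj_words_disjoint A B u : words (B :\: A) u -> proj A u = [::].
Proof.
by elim: u => //= e u IH /andP[]; rewrite !inE => /andP[/negPf-> _] /IH.
Qed.

Lemma proj_words_setI A B w : words A w -> proj B w = proj (A :&: B) w.
Proof.
by move=> /allP wA; apply: eq_in_filter => e /wA /=; rewrite inE => ->.
Qed.

(** * Synchronous products and their projections *)

Lemma prefix_closed_sync A M B N :
  prefix_closed M -> prefix_closed N -> prefix_closed (sync A M B N).
Proof.
move=> clM clN; apply: prefix_closedW => s u [/words_catl ws].
rewrite !proj_cat => /(prefix_closed_catl clM) Ms.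
by move=> /(prefix_closed_catl clN) Ns.
Qed.

Lemma prefix_closed_invproj A B N :
  prefix_closed N -> prefix_closed (invproj A B N).
Proof.
move=> clN; apply: prefix_closedW => s u [/words_catl ws].
by rewrite /= proj_cat => /(prefix_closed_catl clN).
Qed.

Lemma syncC A M B N : sync A M B N = sync B N A M.
Proof. by apply/seteqP; split=> w [] ? ? ?; split=> //; rewrite finset.setUC. Qed.

(** Induction on both words: a head private to one alphabet is emitted at once, and two shared heads
    coincide because the projections agree. *)
Lemma words_merge A B v1 v2 :
  words A v1 -> words B v2 -> proj B v1 = proj A v2 ->
  exists w, [/\ words (A :|: B) w, proj A w = v1 & proj B w = v2].
Proof.
elim: v1 v2 => [|a v1 IH1].
  move=> v2 _ v2B /esym pv2; exists v2; split=> //; last exact/all_filterP.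
  by apply: sub_all v2B => e; rewrite !inE => ->; rewrite orbT.
elim=> [|b v2 IH2] v1A v2B.
  move=> pv1; exists (a :: v1); split=> //; last exact/all_filterP.
  by apply: sub_all v1A => e; rewrite !inE => ->.
have /andP[aA v1A'] := v1A; have /andP[bB v2B'] := v2B.
rewrite /=; case: ifP => aB.
  case: ifP => bA.
    case=> <- /(IH1 _ v1A' v2B')[w [wAB p1 p2]]; exists (a :: w).
    by rewrite /words /= aA aB inE aA -/(proj A w) -/(proj B w) p1 p2.
  rewrite -/(proj A v2) => p12.
  have [|w [wAB p1 p2]] := IH2 v1A v2B'; first by rewrite /= aB.
  exists (b :: w).
  by rewrite /words /= bA bB !inE bB orbT -/(proj A w) -/(proj B w) p1 p2.
move=> /(IH1 (b :: v2) v1A' v2B)[w [wAB p1 p2]]; exists (a :: w).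
by rewrite /words /= aA aB inE aA -/(proj A w) -/(proj B w) p1 p2.
Qed.

(** By [words_merge], the other component constrains [v] only through the shared events. *)
Lemma proj_sync A M B N v : M `<=` words A -> N `<=` words B ->
  (proj A @` sync A M B N) v <->
  M v /\ (proj (A :&: B) @` N) (proj (A :&: B) v).
Proof.
move=> MA NB; split=> [[w [_ Mw Nw] <-]|[Mv [v' Nv' pv]]].
  split=> //; exists (proj B w) => //.
  by rewrite !proj_proj ?finset.subsetIl ?finset.subsetIr.
have [|w [wAB p1 p2]] := words_merge (MA _ Mv) (NB _ Nv').
  rewrite (proj_words_setI _ (MA _ Mv)) (proj_words_setI _ (NB _ Nv')).
  by rewrite (finset.setIC B).
by exists w => //; split; rewrite ?p1 ?p2.
Qed.

(** With Sigma_k as the shared alphabet, this lets the two components be treated separately when P_k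
    of their product is shown controllable. *)
Lemma projI_sync A M B N t : M `<=` words A -> N `<=` words B ->
  (proj (A :&: B) @` sync A M B N) t <->
  (proj (A :&: B) @` M) t /\ (proj (A :&: B) @` N) t.
Proof.
move=> MA NB; split=> [[w Mw <-]|[[v Mv <-] Nt]].
  have /(proj_sync _ MA NB)[Mv] : (proj A @` sync A M B N) (proj A w) by exists w.
  rewrite proj_proj ?finset.subsetIl // => Nw; split=> //.
  by exists (proj A w) => //; rewrite proj_proj ?finset.subsetIl.
have /(proj_sync _ MA NB)[w Mw <-] := conj Mv Nt.
by exists w => //; rewrite proj_proj ?finset.subsetIl.
Qed.

(** * Controllability and supremal controllable sublanguages *)

Lemma controllable_pclosure M N U :
  controllable M N U -> controllable (pclosure M) N U.
Proof. by rewrite /controllable pclosure_pclosure. Qed.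

Lemma controllable_cat M N U s u :
  prefix_closed M -> prefix_closed N -> controllable M N U ->
  M s -> words U u -> N (s ++ u) -> M (s ++ u).
Proof.
move=> clM clN ctM Ms; elim/last_ind: u => [|u e IH]; first by rewrite cats0.
rewrite /words /= all_rcons -rcons_cat => /andP[eU uU] Nsue.
rewrite -clM; apply: ctM => //; rewrite clM; apply: IH => //.
by apply: (prefix_closed_catl (u := [:: e])); rewrite // cats1.
Qed.

Lemma supC_subl M N U : supC M N U `<=` M.
Proof. by move=> w [M' [M'MN _] /M'MN[]]. Qed.

Lemma supC_subr M N U : supC M N U `<=` N.
Proof. by move=> w [M' [M'MN _] /M'MN[]]. Qed.

Lemma supC_max M N U M' :
  M' `<=` M -> M' `<=` N -> controllable M' N U -> M' `<=` supC M N U.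
Proof.
by move=> M'M M'N ctM' w M'w; exists M' => //; split=> // v ?; split; auto.
Qed.

(** A prefix of a word of the union is a prefix of a word of a single member, whose own
    controllability supplies the extension. *)
Lemma controllable_supC M N U : controllable (supC M N U) N U.
Proof.
move=> s e [u [M' [M'MN ctM'] M'su]] eU Nse.
have [|v M'v] := ctM' s e _ eU Nse; first by exists u.
by exists v, M'.
Qed.

(** The closure of [supC M N U] is again controllable and inside [M] and [N], so maximality absorbs
    it. *)
Lemma prefix_closed_supC M N U :
  prefix_closed M -> prefix_closed N -> prefix_closed (supC M N U).
Proof.
move=> clM clN; apply/seteqP; split; last exact: subset_pclosure.
apply: supC_max.
- by move=> s /(pclosure_subset (@supC_subl _ _ _)); rewrite clM.
- by move=> s /(pclosure_subset (@supC_subr _ _ _)); rewrite clN.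
- exact/controllable_pclosure/controllable_supC.
Qed.

End Languages.

(** * One component together with the coordinator *)

Section Coordination.
Variables (E : finType) (Si Sk Su : {set E}) (Gi : generator Si).
Let A := Si :|: Sk.

(** The conclusion offers some [v] rather than [rcons w e], since events outside [Sk] may have to
    occur before [e] becomes possible. *)
Lemma observer_lcc_controllable_extension (C Nk : set (seq E)) w e :
  observer A Sk (invproj A Si (lang Gi)) ->
  lcc A Sk Su (invproj A Si (lang Gi)) ->
  prefix_closed Nk -> prefix_closed C -> C `<=` invproj A Si (lang Gi) ->
  controllable C (sync Si (lang Gi) Sk Nk) (A :&: Su) ->
  C w -> e \in Sk :&: Su -> Nk (rcons (proj Sk w) e) ->
  (proj Sk @` invproj A Si (lang Gi)) (rcons (proj Sk w) e) ->
  exists2 v, C v & proj Sk v = rcons (proj Sk w) e.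
Proof.
move=> obs cons clNk clC CL ctC Cw eSku Nke Le.
have /finset.setIP[eSk eSu] := eSku.
have clL := prefix_closed_invproj A Si (lang_prefix_closed Gi).
have [u [uA Lwu /eqP]] := obs _ _ Le (subset_pclosure (CL _ Cw)) (prefix_rcons _ _).
rewrite proj_cat -[X in _ == X]cats1 eqseq_cat // eqxx /= => /eqP pu.
(* The projection of [u] is the single event [e], so only events outside [Sk] precede it. *)
have [u1 [u2 [eu u1Sk]]] : exists u1 u2,
    u = u1 ++ e :: u2 /\ words (A :\: Sk) u1.
  elim: u uA pu {Lwu} => //= a u IH /andP[aA uA]; case: ifP => aSk.
    by case=> -> _; exists [::], u.
  move=> /(IH uA)[u1 [u2 [-> wu1]]]; exists (a :: u1), u2.
  by rewrite /words /= inE aSk aA.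
(* The word [u1] refutes the first alternative of LCC; the second gives an uncontrollable [u']. *)
have [[]|[u' [wu' Lu']]] := cons _ _ (CL _ Cw) eSku Le.
  exists u1; split=> //; apply: (prefix_closed_catl (u := u2) clL).
  by rewrite -catA cat_rcons -eu.
have pw : proj Sk (w ++ rcons u' e) = rcons (proj Sk w) e.
  by rewrite -rcons_cat proj_rcons eSk proj_cat (proj_words_disjoint wu') cats0.
exists (w ++ rcons u' e) => //.
apply: (controllable_cat clC _ ctC Cw).
- exact: prefix_closed_sync (lang_prefix_closed Gi) clNk.
- rewrite /words /= all_rcons !inE eSk eSu orbT /=.
  by apply: sub_all wu' => x; rewrite !inE => /andP[_].
- by case: Lu' => wA Lw; split=> //; rewrite pw.
Qed.

(* Only events of Sk matter for the second factor, and there controllability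
   of [Xk] in [Nk] supplies membership in [Xk]. *)
Lemma controllable_sync_coordinator (X Xk Ck Nk : set (seq E)) :
  pclosure (proj Sk @` X) `<=` pclosure Xk -> Ck `<=` Nk ->
  controllable Xk Nk (Sk :&: Su) ->
  controllable X (sync Si (lang Gi) Sk (pclosure Xk)) (A :&: Su) ->
  controllable X (sync Si (lang Gi) Sk Ck) (A :&: Su).
Proof.
move=> XXk CN ctXk ctX s e Xs eAu [ws Ls Ck_se]; apply: ctX => //; split=> //.
have Xk_s : pclosure Xk (proj Sk s).
  by apply: XXk; case: Xs => u Xsu; exists (proj Sk u), (s ++ u); rewrite ?proj_cat.
move: Ck_se; rewrite proj_rcons; case: ifP => // eSk Ck_se.
have /finset.setIP[_ eSu] := eAu.
by apply: ctXk; [|rewrite inE eSk|exact: CN].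
Qed.

(** An extension allowed here already projects into both P_k(C) and P_k(D). The [D] side is then
    settled, and P_k(C) lies in [Ck], so controllability of [C] settles the other. *)
Lemma controllable_proj_sync (B : {set E}) (C D Ck : set (seq E)) :
  A :&: B = Sk -> prefix_closed C -> prefix_closed D ->
  C `<=` words A -> D `<=` words B -> proj Sk @` C `<=` Ck ->
  controllable C (sync Si (lang Gi) Sk Ck) (A :&: Su) ->
  controllable (proj A @` sync A C B D)
    (sync Si (lang Gi) Sk (pclosure (proj Sk @` sync A C B D))) (A :&: Su).
Proof.
move=> AB clC clD CA DB CCk ctC s e.
have clM := prefix_closed_sync A B clC clD.
rewrite !(prefix_closed_proj _ clM).
move=> /(proj_sync _ CA DB)[Cs _] eAu [ws Ls].
rewrite -{1}AB => /(projI_sync _ CA DB); rewrite AB => -[Ck_se D_se].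
apply/proj_sync => //; rewrite AB; split=> //.
by rewrite -clC; apply: ctC; rewrite ?clC //; split=> //; exact: CCk.
Qed.

End Coordination.

(** * Conditional controllability and maximality of the composed language *)

Theorem theorem10 (E : finType) (S1 S2 Sk Su : {set E})
    (G1 : generator S1) (G2 : generator S2) (Gk : generator Sk)
    (K : set (seq E))
    (h12k : S1 :&: S2 \subset Sk) (hk12 : Sk \subset S1 :|: S2)
    (hu : Su \subset S1 :|: S2)
    (Kreg : regular (S1 :|: S2) K)
    (KL : K `<=` lang (gsync (gsync G1 G2) Gk))
    (Kpref : prefix_closed K)
    (Kdec : cond_decomposable S1 S2 Sk K)
    (obs1 : observer (S1 :|: Sk) Sk (invproj (S1 :|: Sk) S1 (lang G1)))
    (obs2 : observer (S2 :|: Sk) Sk (invproj (S2 :|: Sk) S2 (lang G2)))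
    (lcc1 : lcc (S1 :|: Sk) Sk Su (invproj (S1 :|: Sk) S1 (lang G1)))
    (lcc2 : lcc (S2 :|: Sk) Sk Su (invproj (S2 :|: Sk) S2 (lang G2))) :
  let supCk := supC (proj Sk @` K) (lang Gk) (Sk :&: Su) in
  let supC1k := supC (proj (S1 :|: Sk) @` K)
                  (sync S1 (lang G1) Sk (pclosure supCk))
                  ((S1 :|: Sk) :&: Su) in
  let supC2k := supC (proj (S2 :|: Sk) @` K)
                  (sync S2 (lang G2) Sk (pclosure supCk))
                  ((S2 :|: Sk) :&: Su) in
  sync (S1 :|: Sk) supC1k (S2 :|: Sk) supC2k = supcC Su G1 G2 Gk K.
Proof.
move=> Ck C1 C2.
have clKp A : prefix_closed (proj A @` K) := prefix_closed_proj A Kpref.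
have clCk : prefix_closed Ck.
  exact: prefix_closed_supC (clKp _) (lang_prefix_closed Gk).
have CkL : Ck `<=` lang Gk by exact: supC_subr.
have clsync Si (Gi : generator Si) :
    prefix_closed (sync Si (lang Gi) Sk (pclosure Ck)).
  by rewrite clCk; apply: prefix_closed_sync => //; exact: lang_prefix_closed.
have clC1 : prefix_closed C1 := prefix_closed_supC _ (clKp _) (clsync _ G1).
have clC2 : prefix_closed C2 := prefix_closed_supC _ (clKp _) (clsync _ G2).
have S12 : (S1 :|: Sk) :&: (S2 :|: Sk) = Sk.
  by rewrite -finset.setUIl; exact/finset.setUidPr.
have S21 : (S2 :|: Sk) :&: (S1 :|: Sk) = Sk by rewrite finset.setIC.
have KS w : K w -> [/\ words (S1 :|: S2) w, lang G1 (proj S1 w) &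
    lang G2 (proj S2 w)].
  move=> /KL; rewrite lang_gsync => -[wS + _]; rewrite lang_gsync => -[_].
  rewrite !proj_proj ?finset.subsetUl ?finset.subsetUr // => L1 L2; split=> //.
  by move: wS; rewrite (finset.setUidPl hk12).
have KpL1 : proj (S1 :|: Sk) @` K `<=` invproj (S1 :|: Sk) S1 (lang G1).
  move=> _ [w /KS[_ Lw _] <-]; split; first exact: words_proj.
  by rewrite /= proj_proj ?finset.subsetUl.
have KpL2 : proj (S2 :|: Sk) @` K `<=` invproj (S2 :|: Sk) S2 (lang G2).
  move=> _ [w /KS[_ _ Lw] <-]; split; first exact: words_proj.
  by rewrite /= proj_proj ?finset.subsetUl.
have C1L : C1 `<=` invproj (S1 :|: Sk) S1 (lang G1).
  by move=> w /supC_subl /KpL1.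
have C2L : C2 `<=` invproj (S2 :|: Sk) S2 (lang G2).
  by move=> w /supC_subl /KpL2.
have C1A : C1 `<=` words (S1 :|: Sk) by move=> w /C1L[].
have C2A : C2 `<=` words (S2 :|: Sk) by move=> w /C2L[].
have ctC1 : controllable C1 (sync S1 (lang G1) Sk Ck) ((S1 :|: Sk) :&: Su).
  by rewrite -[X in sync _ _ _ X]clCk; exact: controllable_supC.
have ctC2 : controllable C2 (sync S2 (lang G2) Sk Ck) ((S2 :|: Sk) :&: Su).
  by rewrite -[X in sync _ _ _ X]clCk; exact: controllable_supC.
have C1Ck : proj Sk @` C1 `<=` Ck.
  by move=> _ [w /supC_subr[_ _] + <-]; rewrite clCk.
have C2Ck : proj Sk @` C2 `<=` Ck.
  by move=> _ [w /supC_subr[_ _] + <-]; rewrite clCk.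
have clM := prefix_closed_sync (S1 :|: Sk) (S2 :|: Sk) clC1 clC2.
have pM t : (proj Sk @` sync (S1 :|: Sk) C1 (S2 :|: Sk) C2) t <->
    (proj Sk @` C1) t /\ (proj Sk @` C2) t.
  by have := projI_sync t C1A C2A; rewrite S12.
apply/seteqP; split.
  (* First inclusion: the product is itself a member of the union defining [supcC]. Conditional
     decomposability places it inside [K]. *)
  move=> w Mw; exists (sync (S1 :|: Sk) C1 (S2 :|: Sk) C2) => //.
  have MK : sync (S1 :|: Sk) C1 (S2 :|: Sk) C2 `<=` K.
    by move=> v [wv /supC_subl K1 /supC_subl K2]; rewrite Kdec.
  split=> //; split; first by move=> v /MK/KL.
  - move=> s e; rewrite (prefix_closed_proj _ clM).
    move=> /pM[[w1 Cw1 ew1] [w2 Cw2 ew2]] eSku Lse.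
    have Cs : Ck s by apply: C1Ck; exists w1.
    have Cse : Ck (rcons s e).
      by rewrite -clCk; apply: controllable_supC => //; rewrite clCk.
    (* The projections of [x] show that [rcons s e] is feasible in both inverse images, as the
       observer and LCC conditions require. *)
    have [x Kx ex] : (proj Sk @` K) (rcons s e) := supC_subl Cse.
    (* The two components are extended independently; [pM] merges the results even if their events
       outside [Sk] are unrelated. *)
    apply/pM; split.
    + have [||v Cv ev] := observer_lcc_controllable_extension
        obs1 lcc1 clCk clC1 C1L ctC1 Cw1 eSku; rewrite ?ew1 //.
        exists (proj (S1 :|: Sk) x); first by apply: KpL1; exists x.
        by rewrite proj_proj ?finset.subsetUr.
      by exists v; rewrite // ev ew1.
    + have [||v Cv ev] := observer_lcc_controllable_extension
        obs2 lcc2 clCk clC2 C2L ctC2 Cw2 eSku; rewrite ?ew2 //.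
        exists (proj (S2 :|: Sk) x); first by apply: KpL2; exists x.
        by rewrite proj_proj ?finset.subsetUr.
      by exists v; rewrite // ev ew2.
  - exact: (controllable_proj_sync (Ck := Ck)).
  - by rewrite syncC; exact: (controllable_proj_sync (Ck := Ck)).
(* Second inclusion: the projections of a conditionally controllable [X] compete in the unions
   defining [Ck], [C1] and [C2]. *)
move=> w [X [XK [XL ctk ct1 ct2]] Xw].
have XCk : proj Sk @` X `<=` Ck.
  apply: supC_max => //; first exact: image_subset.
  by move=> _ [v /XL + <-]; rewrite lang_gsync => -[].
have Xproj Si : pclosure (proj Sk @` (proj (Si :|: Sk) @` X)) `<=`
    pclosure (proj Sk @` X).
  apply: pclosure_subset => _ [_ [v Xv <-] <-]; exists v => //.
  by rewrite proj_proj ?finset.subsetUr.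
have projXCk Si v : X v -> pclosure Ck (proj Sk (proj (Si :|: Sk) v)).
  by move=> Xv; rewrite clCk proj_proj ?finset.subsetUr //; apply: XCk; exists v.
split.
- by have [+ _ _] := KS _ (XK _ Xw); rewrite -finset.setUUl (finset.setUidPl hk12).
- apply: (@supC_max _ _ _ _ (proj (S1 :|: Sk) @` X)); last by exists w.
  + exact: image_subset.
  + move=> _ [v Xv <-]; split; [exact: words_proj| |exact: projXCk].
    by have [] := KpL1 (proj (S1 :|: Sk) v); [exists v => //; exact: XK|].
  (* In [ct1] the coordinator part is the closure of P_k(X), here it is the larger [Ck];
     controllability of P_k(X) in L(G_k) bridges the gap. *)
  + by rewrite clCk; exact: controllable_sync_coordinator ctk ct1.
- apply: (@supC_max _ _ _ _ (proj (S2 :|: Sk) @` X)); last by exists w.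
  + exact: image_subset.
  + move=> _ [v Xv <-]; split; [exact: words_proj| |exact: projXCk].
    by have [] := KpL2 (proj (S2 :|: Sk) v); [exists v => //; exact: XK|].
  + by rewrite clCk; exact: controllable_sync_coordinator ctk ct2.
Qed.
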